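(* For any $2$-connected graph $G$ of order $n$ and any vertex $x$ of $G$, we have $av(G,x)\leq (n-1)/2$, with equality if and only if $G=K_3$.
   Context: A set of vertices is a connected set if it induces a connected subgraph. $G-x$ is the subgraph induced by $V(G)\setminus\{x\}$; $\mathcal C(G-x)$ is the collection of nonempty connected sets of $G-x$; $\mathcal C(G,x)$ is the collection of connected sets of $G$ containing $x$. Definition of $av(G,x)$: fix a shortest distance spanning tree $T$ of $G$ rooted at $x$ (for each vertex $v$, the path in $T$ from $v$ to $x$ has length equal to the distance from $v$ to $x$ in $G$). For each $U\in\mathcal C(G-x)$ choose a vertex $v_U\in U$ closest to $x$, and let $p_U$ be the path in $T$ between $v_U$ and $x$, regarded as its vertex set; $|p_U|$ denotes its length (number of edges). Let $\overline U=U\cup p_U$. For $Q\in\mathcal C(G,x)$ let $W(Q)=\{U\in\mathcal C(G-x):\overline U=Q\}$, ordered by $U\preceq U'$ iff $p_{U'}\subseteq p_U$; when $W(Q)\ne\emptyset$ let $U_Q$ be the minimal element of $W(Q)$. Let $\mathcal M(G-x)=\{U_Q: Q\in\mathcal C(G,x),\ W(Q)\neq\emptyset\}$ and $av(G,x)=\frac{1}{|\mathcal M(G-x)|}\sum_{U\in\mathcal M(G-x)}|p_U|$. *)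

(* Defs.v *)
From mathcomp Require Import all_boot all_order all_algebra.

Set Implicit Arguments.
Unset Strict Implicit.
Unset Printing Implicit Defensive.

Import Order.TTheory GRing.Theory Num.Theory.

(* A finite simple graph is a symmetric irreflexive relation [e] on a finite
   vertex type [V]; these two properties are hypotheses of the theorem. *)

Section Graphs.

Variable V : finType.
Implicit Types (e t : rel V) (u v w x : V) (A S U Q : {set V}).

(* The empty set counts as connected here; nonemptiness is imposed separately
   where it matters. *)
Definition connected_set e A : bool :=
  [forall u in A, forall v in A, connect [rel a b in A | e a b] u v].

Definition k_connected (k : nat) e : Prop :=
  k < #|V| /\ forall S, #|S| < k -> connected_set e (~: S).

(* Length of a shortest walk from [u] to [v] (and #|V| if there is none). *)
Definition dist e u v : nat :=
  find (fun k => [exists p : k.-tuple V, path e u p && (last u p == v)])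
       (iota 0 #|V|).

Definition simple_path e u v (p : seq V) : bool :=
  [&& path e u p, last u p == v & uniq (u :: p)].

(* [ucycle t [:: a; b]] holds for every edge ab, so genuine cycles are those
   with at least three vertices. *)
Definition spanning_tree e t : Prop :=
  [/\ subrel t e, symmetric t, forall u v, connect t u v
    & forall c : seq V, ucycle t c -> size c <= 2].

(* The simple path from [u] to [v] (unique when [t] is a tree), given as in
   [path]: without its first vertex [u], so that its [size] is its number of
   edges. *)
Definition tree_path t u v : seq V :=
  if [pick p : #|V|.-bseq V | simple_path t u v p] is Some p then p
  else [::].

Definition shortest_distance_tree e x t : Prop :=
  spanning_tree e t /\ forall v, size (tree_path t v x) = dist e v x.

Definition conn_sets_minus e x : {set {set V}} :=
  [set U : {set V} | [&& U != set0, U \subset [set~ x] & connected_set e U]].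

Definition conn_sets_at e x : {set {set V}} :=
  [set Q : {set V} | (x \in Q) && connected_set e Q].

(* [c U] is the chosen vertex v_U. *)
Definition closest_choice e x (c : {set V} -> V) : Prop :=
  forall U, U \in conn_sets_minus e x ->
    c U \in U /\ forall w, w \in U -> dist e (c U) x <= dist e w x.

Section Average.

Variables (e : rel V) (x : V) (t : rel V) (c : {set V} -> V).

Definition pathU U : {set V} := [set w in c U :: tree_path t (c U) x].

Definition pathU_length U : nat := size (tree_path t (c U) x).

Definition bar U : {set V} := U :|: pathU U.

Definition W Q : {set {set V}} := [set U in conn_sets_minus e x | bar U == Q].

Definition prec U U' : bool := pathU U' \subset pathU U.

Definition minimal_in_W Q U : bool :=
  (U \in W Q) && [forall U' in W Q, prec U' U ==> (U' == U)].

(* Each nonempty W(Q) has exactly one minimal element, as [prec] is a total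
   order on W(Q) when [t] is a shortest distance tree and [c] a closest
   choice. *)
Definition M : {set {set V}} :=
  [set U : {set V} | [exists Q in conn_sets_at e x, minimal_in_W Q U]].

Definition av : rat :=
  ((\sum_(U in M) (pathU_length U)%:R) / #|M|%:R)%R.

End Average.

End Graphs.

Definition complete_graph (n : nat) : rel 'I_n := [rel i j | i != j].

Definition graph_iso (V1 V2 : finType) (e1 : rel V1) (e2 : rel V2) : Prop :=
  exists2 f : V1 -> V2, bijective f & forall u v, e1 u v = e2 (f u) (f v).

(* Main.v *)
(* By 2-connectedness every distance class strictly between [x] and a vertex at
   distance [m] has at least two vertices, so [2m <= n], and at most one vertex
   attains [2m = n].  Hence [2|p_U| <= n - 1] for all [U] with at most one
   exception, where it fails by 1.  Two neighbours of [x] give singletons in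
   M(G - x) with [|p_U| = 1], and their deficit outweighs the exception as soon
   as [n > 3]. *)
Require Import Defs.
From mathcomp Require Import all_boot all_order all_algebra.
From mathcomp Require Import zify.

Set Implicit Arguments.
Unset Strict Implicit.
Unset Printing Implicit Defensive.

Import Order.TTheory GRing.Theory Num.Theory.

(** * Distance as a bounded search over walk lengths *)

Section Distance.

Variables (V : finType) (e : rel V).
Implicit Types (u v w : V) (k : nat).

Lemma dist_le_card u v : dist e u v <= #|V|.
Proof. by rewrite /dist -[leqRHS](size_iota 0) find_size. Qed.

Lemma dist_le_walk u v (p : seq V) :
  path e u p -> last u p = v -> dist e u v <= size p.
Proof.
(* Lengths from [#|V|] on are never searched; for them the cap [#|V|] on [dist] suffices. *)
move=> pP lP; case: (ltnP (size p) #|V|) => [lt_p|]; last first.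
  by apply: leq_trans; apply: dist_le_card.
rewrite leqNgt; apply/negP => /(before_find 0).
rewrite nth_iota // add0n => /existsP; apply.
by exists (in_tuple p); rewrite /= pP lP eqxx.
Qed.

(** A value below [#|V|] is not the default: the search stopped at an actual walk. *)
Lemma dist_walk u v : dist e u v < #|V| ->
  exists p : seq V, [/\ path e u p, last u p = v & size p = dist e u v].
Proof.
move=> lt_d; have := lt_d; rewrite -[X in _ < X](size_iota 0) -has_find.
move=> /(nth_find 0); rewrite nth_iota // add0n => /existsP[p /andP[pP /eqP lP]].
by exists p; rewrite size_tuple.
Qed.

Lemma dist_edge u v w : e u v -> dist e u w <= (dist e v w).+1.
Proof.
move=> euv; case: (ltnP (dist e v w) #|V|) => [/dist_walk[p [pP lP <-]]|].
  by apply: (@dist_le_walk _ _ (v :: p)) => //=; rewrite euv.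
by move=> le_n; apply: leq_trans (dist_le_card _ _) _; apply: leqW.
Qed.

Lemma dist_eq0 u v : (dist e u v == 0) = (u == v).
Proof.
apply/eqP/eqP => [d0|->]; last first.
  by apply/eqP; rewrite -leqn0; apply: (@dist_le_walk _ _ [::]).
have [|p [_ lP]] := @dist_walk u v; first by rewrite d0; apply/card_gt0P; exists u.
by rewrite d0 => /size0nil p0; rewrite p0 in lP.
Qed.

Lemma dist_eq1 u v : irreflexive e -> 1 < #|V| -> (dist e u v == 1) = e u v.
Proof.
move=> e_irr V_gt1; apply/eqP/idP => [d1|euv].
  have [|p []] := @dist_walk u v; rewrite d1 //.
  by case: p => [|w [|]] //= /andP[euw _] <-.
apply/eqP; rewrite eqn_leq lt0n dist_eq0.
have -> : u != v by apply: contraTneq euv => ->; rewrite e_irr.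
by rewrite andbT (@dist_le_walk _ _ [:: v]) //= euv.
Qed.

End Distance.

(** * Sizes of distance classes and balls in a 2-connected graph *)

Section TwoConnected.

Variables (V : finType) (e : rel V) (x : V).
Hypothesis (e_2conn : k_connected 2 e).

Let V_gt2 : 2 < #|V|. Proof. by case: e_2conn. Qed.

(** Deleting at most one vertex leaves [v] and [x] connected, but every walk between them meets
    class [k]. *)
Lemma card_level_ge2 k v : 0 < k -> k < dist e v x ->
  1 < #|[set w | dist e w x == k]|.
Proof.
move=> k_gt0 lt_kv; rewrite ltnNge; apply/negP => le1.
have := e_2conn.2 _ le1 => /forall_inP/(_ v).
rewrite !inE gtn_eqF // => /(_ isT)/forall_inP/(_ x).
have dxx : dist e x x = 0 by apply/eqP; rewrite dist_eq0.
rewrite !inE dxx eq_sym gtn_eqF // => /(_ isT)/connectP[p].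
(* An edge lowers the distance to [x] by at most 1 and the value [k] is avoided, so the walk stays
   beyond [k] and never reaches [x]. *)
elim: p v lt_kv => [|w p IH] v lt_kv /=; first by move=> _ xv; rewrite -xv dxx in lt_kv.
rewrite !inE => /andP[/andP[/andP[_ dw] evw] pP]; apply: (IH w) => //.
by have := dist_edge x evw; lia.
Qed.

(** Count [x] itself and two vertices in each of the classes 1 to [k]. *)
Lemma card_ball_ge v k : k < dist e v x ->
  k.*2.+1 <= #|[set w | dist e w x <= k]|.
Proof.
elim: k => [_|k IH lt_kv].
  by apply/card_gt0P; exists x; rewrite inE leqn0 dist_eq0.
have -> : [set w | dist e w x <= k.+1] =
    [set w | dist e w x <= k] :|: [set w | dist e w x == k.+1].
  by apply/setP => w; rewrite !inE [LHS]leq_eqVlt orbC.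
rewrite cardsU disjoint_setI0 ?cards0 ?subn0; last first.
  by rewrite -setI_eq0; apply/eqP/setP => w; rewrite !inE; lia.
have := IH (ltnW lt_kv); have := card_level_ge2 (ltn0Sn k) lt_kv; lia.
Qed.

(** With d the distance from [v] to [x], the complement of the far set is the ball of radius d - 1,
    which has at least 2d - 1 vertices. *)
Lemma card_far_le v : v != x ->
  (dist e v x).*2 + #|[set w | dist e v x <= dist e w x]| <= #|V|.+1.
Proof.
rewrite -(dist_eq0 e) -lt0n => d_gt0.
have := @card_ball_ge v (dist e v x).-1; rewrite ltn_predL d_gt0 => /(_ isT).
rewrite -(cardsC [set w | dist e v x <= dist e w x]).
have -> : ~: [set w | dist e v x <= dist e w x] =
    [set w | dist e w x <= (dist e v x).-1].
  by apply/setP => w; rewrite !inE; lia.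
lia.
Qed.

Lemma card_neighbours_ge2 : 1 < #|[set w | dist e w x == 1]|.
Proof.
(* If nothing lies beyond distance 1, all the other n - 1 >= 2 vertices are neighbours of [x]. *)
have [/existsP[v]|/existsPn near] := boolP [exists v, 1 < dist e v x].
  exact: card_level_ge2.
have -> : [set w | dist e w x == 1] = [set~ x].
  apply/setP => w; rewrite !inE -(dist_eq0 e).
  by have := near w; lia.
by rewrite cardsC1; lia.
Qed.

(** Deleting the third vertex leaves [u] and [v] connected, and without loops the first step of a
    walk from [u] must go to [v]. *)
Lemma edge_order3 u v : irreflexive e -> #|V| = 3 -> u != v -> e u v.
Proof.
move=> e_irr V3 uv; have cS : #|~: [set u; v]| < 2.
  by have := cardsC [set u; v]; rewrite cards2 uv V3; lia.
have := e_2conn.2 _ cS; rewrite setCK => /forall_inP/(_ u).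
rewrite !inE eqxx => /(_ isT)/forall_inP/(_ v); rewrite !inE eqxx orbT.
move=> /(_ isT)/connectP[[|w p] /=]; first by move=> _ vu; rewrite vu eqxx in uv.
rewrite !inE => /andP[/andP[/andP[_ /orP[]/eqP->]]] //.
by rewrite e_irr.
Qed.

End TwoConnected.

Lemma order3_iff_K3 (V : finType) (e : rel V) :
  irreflexive e -> k_connected 2 e ->
  #|V| = 3 <-> graph_iso e (@complete_graph 3).
Proof.
move=> e_irr e_2conn; split=> [V3|[f f_bij _]]; last first.
  by rewrite (bij_eq_card f_bij) card_ord.
(* Any bijection will do, since both graphs are complete. *)
have f_bij : bijective (fun v : V => cast_ord V3 (enum_rank v)).
  exact: bij_comp (Bijective (cast_ordK V3) (cast_ordKV V3)) (@enum_rank_bij V).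
exists (fun v => cast_ord V3 (enum_rank v)) => // u v.
rewrite /complete_graph /= (bij_eq f_bij).
by have [->|uv] := eqVneq u v; [rewrite e_irr | rewrite edge_order3].
Qed.

(** * Path lengths over [M] and their average *)

Section Lengths.

Variables (V : finType) (e t : rel V) (x : V) (c : {set V} -> V).
Hypotheses (e_sym : symmetric e) (e_irr : irreflexive e).
Hypotheses (e_2conn : k_connected 2 e).
Hypotheses (t_sdt : shortest_distance_tree e x t).
Hypotheses (c_closest : closest_choice e x c).

Let len (U : {set V}) := pathU_length x t c U.

Let lenE U : len U = dist e (c U) x. Proof. exact: t_sdt.2. Qed.

Let V_gt1 : 1 < #|V|. Proof. exact: ltnW e_2conn.1. Qed.

Lemma M_conn_sets U : U \in M e x t c -> U \in conn_sets_minus e x.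
Proof.
by rewrite inE => /exists_inP[Q _ /andP[]]; rewrite inE => /andP[].
Qed.

Lemma pathU_length_gt0 U : U \in M e x t c -> 0 < len U.
Proof.
move=> /M_conn_sets UP; have [cU _] := c_closest UP.
move: UP; rewrite inE lenE lt0n dist_eq0 => /and3P[_ /subsetP/(_ _ cU)].
by rewrite !inE.
Qed.

(* Only the set of all vertices at distance at least n/2 can reach length n/2. *)
Lemma pathU_length_le U : U \in M e x t c ->
  (len U).*2 <= #|V|.-1 + (U == [set w | #|V| <= (dist e w x).*2]).
Proof.
move=> UM; have [cU c_min] := c_closest (M_conn_sets UM).
have cUx : c U != x by rewrite -(dist_eq0 e) -lenE -lt0n pathU_length_gt0.
have := card_far_le e_2conn cUx; rewrite -lenE.
set F := [set w | len U <= _] => le_n.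
have sUF : U \subset F by apply/subsetP => w /c_min; rewrite inE lenE.
have F_gt0 : 0 < #|F| by apply/card_gt0P; exists (c U); apply: (subsetP sUF).
case: eqP => [_|neq]; first by lia.
(* Otherwise [le_n] forces 2 [len U] = n and |F| = 1, so the nonempty subset [U] of [F] equals
   [F]. *)
rewrite addn0; case: (leqP (len U).*2 #|V|.-1) => // gt_n.
case: neq; have -> : [set w | #|V| <= (dist e w x).*2] = F.
  by apply/setP => w; rewrite !inE; lia.
apply/eqP; rewrite eqEcard sUF.
have : 0 < #|U| by apply/card_gt0P; exists (c U).
lia.
Qed.

(** The closure of {y} is {x, y}, and no other nonempty set avoiding [x] has this closure, so
    minimality is automatic. *)
Lemma neighbour_in_M y : e y x -> [set y] \in M e x t c /\ len [set y] = 1.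
Proof.
move=> eyx; have yx : y != x by apply: contraTneq eyx => ->; rewrite e_irr.
have conn1 : [set y] \in conn_sets_minus e x.
  rewrite inE -cards_eq0 cards1 sub1set !inE yx /=.
  by apply/forall_inP => u /set1P->; apply/forall_inP => v /set1P->.
have cy : c [set y] = y by apply/set1P; case: (c_closest conn1).
have len1 : len [set y] = 1 by rewrite lenE cy; apply/eqP; rewrite dist_eq1.
(* Length 1 rules out the default value [[::]]. *)
split=> //; have path_y : tree_path t y x = [:: x].
  move: len1; rewrite /len /pathU_length cy /tree_path.
  case: pickP => // -[/= [|z [|]] //= _] /and3P[_ /eqP /= -> _] //.
have bar_y : bar x t c [set y] = [set x; y].
  by apply/setP => z; rewrite /bar /pathU cy path_y !inE; do 2 case: eqP.
rewrite inE; apply/exists_inP; exists [set x; y].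
  rewrite inE !inE eqxx /=; apply/forall_inP => u uP; apply/forall_inP => v vP.
  have [->|uv] := eqVneq u v; first exact: connect0.
  apply: connect1; rewrite /= uP vP /=.
  by move: uP vP uv; rewrite !inE => /orP[]/eqP-> /orP[]/eqP->;
     rewrite ?eqxx // e_sym.
rewrite /minimal_in_W inE conn1 bar_y eqxx /=.
apply/forall_inP => U; rewrite inE => /andP[UP /eqP barU].
apply/implyP => _; move: UP; rewrite inE => /and3P[U0 /subsetP Ux _].
have sUy : U \subset [set y].
  apply/subsetP => z zU; have : z \in bar x t c U by rewrite inE zU.
  by rewrite barU; have := Ux z zU; rewrite !inE => /negPf->.
by move: sUy; rewrite subset1 (negPf U0) orbF.
Qed.

Lemma two_short_in_M : exists U1 U2 : {set V},
  [/\ U1 \in M e x t c, U2 \in M e x t c, U1 != U2, len U1 = 1 & len U2 = 1].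
Proof.
have /card_gt1P[y1 [y2 []]] := card_neighbours_ge2 x e_2conn.
rewrite !inE !dist_eq1 // => /neighbour_in_M[M1 l1] /neighbour_in_M[M2 l2] ne.
by exists [set y1], [set y2]; rewrite (inj_eq set1_inj).
Qed.

Lemma card_M_gt0 : 0 < #|M e x t c|.
Proof. by have [U [_ [? _ _ _ _]]] := two_short_in_M; apply/card_gt0P; exists U. Qed.

(** After doubling, two sets of length 1 contribute 4 against 2(n - 1), a gap of 2(n - 3) >= 2,
    while the other sets exceed their share by at most 1 in total. *)
Lemma sum_pathU_length_lt : 3 < #|V| ->
  (\sum_(U in M e x t c) len U).*2 < #|M e x t c| * #|V|.-1.
Proof.
move=> V_gt3; have [U1 [U2 [M1 M2 ne l1 l2]]] := two_short_in_M.
have M2' : U2 \in M e x t c :\ U1 by rewrite in_setD1 eq_sym ne.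
rewrite (big_setD1 U1) // (big_setD1 U2) //= l1 l2.
rewrite (cardsD1 U1) M1 (cardsD1 U2 (_ :\ _)) M2'.
set A := _ :\ U2; set F := [set w | #|V| <= (dist e w x).*2].
have le_A : (\sum_(U in A) len U).*2 <= #|A| * #|V|.-1 + 1.
  rewrite -mul2n big_distrr /=.
  apply: (@leq_trans (\sum_(U in A) (#|V|.-1 + (U == F)))).
    apply: leq_sum => U; rewrite !in_setD1 => /and3P[_ _ UM].
    by rewrite mul2n pathU_length_le.
  rewrite big_split /= sum_nat_const leq_add2l.
  (* The indicators count the members of [A] equal to [F], at most one. *)
  rewrite -big_mkcondr /= sum1_card.
  rewrite -(cards1 F) subset_leq_card //.
  by apply/subsetP => U; rewrite unfold_in => /andP[_ /eqP->]; rewrite set11.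
rewrite !doubleD !mulnDl !mul1n; move: V_gt3 le_A.
move: (\sum_(i in A) _) (#|A| * _)%N => S B; move: #|V| => v; lia.
Qed.

(** Every length is positive with double at most 2 + 1, hence equals 1. *)
Lemma av_order3 : #|V| = 3 -> av e x t c = 1%R.
Proof.
move=> V3; rewrite /av -natr_sum.
have -> : \sum_(U in M e x t c) pathU_length x t c U = #|M e x t c|.
  rewrite -sum1_card; apply: eq_bigr => U UM; rewrite -/(len U).
  by have := pathU_length_gt0 UM; have := pathU_length_le UM; rewrite V3; lia.
by rewrite divff // pnatr_eq0 -lt0n card_M_gt0.
Qed.

Lemma av_lt : 3 < #|V| -> (av e x t c < (#|V|%:R - 1) / 2%:R)%R.
Proof.
move=> V_gt3; rewrite /av -natr_sum ltr_pdivrMr ?ltr0n ?card_M_gt0 //.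
rewrite mulrAC ltr_pdivlMr ?ltr0n //.
have -> : (#|V|%:R - 1 = #|V|.-1%:R :> rat)%R by rewrite -subn1 natrB // ltnW.
rewrite -!natrM ltr_nat muln2 mulnC.
exact: sum_pathU_length_lt.
Qed.

End Lengths.

Theorem theorem5p2 (V : finType) (n : nat) (e : rel V) (x : V)
    (t : rel V) (c : {set V} -> V)
    (e_sym : symmetric e) (e_irr : irreflexive e)
    (order_n : #|V| = n)
    (e_2conn : k_connected 2 e)
    (t_sdt : shortest_distance_tree e x t)
    (c_closest : closest_choice e x c) :
  (av e x t c <= (n%:R - 1) / 2%:R)%R /\
  (av e x t c = ((n%:R - 1) / 2%:R)%R <-> graph_iso e (@complete_graph 3)).
Proof.
subst n; rewrite -order3_iff_K3 //.
(* 2-connectedness includes n >= 3: equality holds at n = 3, and the inequality is strict beyond. *)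
have := e_2conn.1; rewrite leq_eqVlt => /predU1P[V3|V_gt3].
  by rewrite (av_order3 e_sym e_irr) // -V3.
have lt_av := av_lt e_sym e_irr e_2conn t_sdt c_closest V_gt3.
split; first exact: ltW.
by split=> [eq_av|V3]; [rewrite eq_av ltxx in lt_av | rewrite V3 in V_gt3].
Qed.
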